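(* Let $Q$ be an Osborn loop. Then the three nuclei $N_\lambda(Q)$, $N_\mu(Q)$, $N_\rho(Q)$ of $Q$ coincide, and the nucleus is a normal subloop of $Q$.
   Context: A loop $Q$ is an Osborn loop if for each $x\in Q$ there exists a permutation $\alpha_x$ of $Q$ such that $\alpha_x(y)\cdot(zx)=x((yz)x)$ for all $y,z\in Q$. The left, middle and right nuclei are $N_\lambda(Q)=\{a;\ a(xy)=(ax)y\ \forall x,y\in Q\}$, $N_\mu(Q)=\{a;\ x(ay)=(xa)y\ \forall x,y\in Q\}$, $N_\rho(Q)=\{a;\ (xy)a=x(ya)\ \forall x,y\in Q\}$. The nucleus is $N(Q)=N_\lambda(Q)\cap N_\mu(Q)\cap N_\rho(Q)$. A subloop is normal if it is invariant under all inner mappings, i.e. under all elements fixing $1$ of the group generated by all left translations $y\mapsto xy$ and right translations $y\mapsto yx$. *)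

(* Defs.v *)
From HB Require Import structures.
From mathcomp Require Import all_boot monoid.
From mathcomp Require Import boolp classical_sets functions.

Set Implicit Arguments.
Unset Strict Implicit.
Unset Printing Implicit Defensive.

Local Open Scope classical_set_scope.
Local Open Scope group_scope.

(* This does not extend umagmaType, which would add a choiceType structure
   to the carrier. *)
HB.mixin Record BaseUMagma_isLoop Q of BaseUMagma Q := {
  loop_mul1l : left_id (1 : Q) *%g;
  loop_mulr1 : right_id (1 : Q) *%g;
  loop_left_bij : forall x : Q, bijective (fun y : Q => x * y);
  loop_right_bij : forall x : Q, bijective (fun y : Q => y * x)
}.

#[short(type="loopType")]
HB.structure Definition Loop := {Q of BaseUMagma_isLoop Q & BaseUMagma Q}.

Section LoopTheory.
Variable Q : loopType.

Definition osborn : Prop :=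
  forall x : Q, exists alpha : Q -> Q,
    bijective alpha /\
    forall y z : Q, alpha y * (z * x) = x * ((y * z) * x).

Definition left_nucleus : set Q :=
  [set a | forall x y : Q, a * (x * y) = (a * x) * y].

Definition middle_nucleus : set Q :=
  [set a | forall x y : Q, x * (a * y) = (x * a) * y].

Definition right_nucleus : set Q :=
  [set a | forall x y : Q, (x * y) * a = x * (y * a)].

Definition nucleus : set Q :=
  left_nucleus `&` middle_nucleus `&` right_nucleus.

(* The subgroup of the symmetric group of Q generated by all translations;
   Q may be infinite, so its elements are maps Q -> Q, and mlt_inv adds the
   two-sided inverse of every element. *)
Inductive mlt : (Q -> Q) -> Prop :=
| mlt_left x : mlt (fun y => x * y)
| mlt_right x : mlt (fun y => y * x)
| mlt_id : mlt id
| mlt_comp f g : mlt f -> mlt g -> mlt (f \o g)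
| mlt_inv f g : mlt f -> cancel f g -> cancel g f -> mlt g.

Definition inner_mapping (f : Q -> Q) : Prop := mlt f /\ f 1 = 1.

(* A is a loop under the restricted operation, with the same unit: set_bij
   contains closure under products as well as unique solvability inside A. *)
Definition subloop (A : set Q) : Prop :=
  [/\ A 1,
      forall a, A a -> set_bij A A (fun y => a * y) &
      forall a, A a -> set_bij A A (fun y => y * a)].

Definition normal_subloop (A : set Q) : Prop :=
  subloop A /\ forall f, inner_mapping f -> f @` A = A.

End LoopTheory.

Arguments osborn : clear implicits.
Arguments left_nucleus : clear implicits.
Arguments middle_nucleus : clear implicits.
Arguments right_nucleus : clear implicits.
Arguments nucleus : clear implicits.

(* Main.v *)
Require Import Defs.
From mathcomp Require Import all_boot monoid.
From mathcomp Require Import boolp classical_sets functions.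

(** The Osborn law says that each x yields an autotopism
    (alpha, R_x, L_x R_x) of Q, where L_x and R_x are the translations by x.
    An element a lies in the left, middle or right nucleus exactly when
    (L_a, id, L_a), (R_a, L_a^-1, id) or (id, R_a, R_a), respectively, is an
    autotopism, and every autotopism with an identity in the corresponding
    place has this form.  So conjugating by (alpha, R_x, L_x R_x) keeps each of
    the three kinds, and comparing components gives the inclusions between the
    nuclei: right in middle ([right_sub_middle]), middle in left
    ([middle_sub_left]), left in middle ([left_sub_middle]).  The remaining
    one, left in right ([left_sub_right]), holds because (L_a, id, L_a)^-1
    composed with (alpha, R_a, L_a R_a) has second and third components R_a.

    The same conjugations show x N = N x for the nucleus N
    ([left_nucleus_conj], [right_nucleus_conj]).  Together with associativity
    of products that involve N, this makes the partition of Q into the cosets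
    x N invariant under all translations, hence under the multiplication group
    ([mlt_coset]); a map in this group that fixes 1 then maps N = 1 N onto
    itself. *)

Set Implicit Arguments.
Unset Strict Implicit.
Unset Printing Implicit Defensive.

Local Open Scope classical_set_scope.
Local Open Scope group_scope.

Section Loop.
Variable Q : loopType.
Implicit Types a x y z : Q.

Lemma loop_mulI x y z : x * y = x * z -> y = z.
Proof. exact: (bij_inj (loop_left_bij x)). Qed.

Lemma loop_mulIr x y z : y * x = z * x -> y = z.
Proof. exact: (bij_inj (loop_right_bij x)). Qed.

Lemma loop_ldiv x y : exists z, x * z = y.
Proof. by have [g _ gK] := loop_left_bij x; exists (g y); apply: gK. Qed.

Lemma loop_rdiv x y : exists z, z * x = y.
Proof. by have [g _ gK] := loop_right_bij x; exists (g y); apply: gK. Qed.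

Lemma left_nucleus1 : left_nucleus Q 1.
Proof. by move=> x y; rewrite !loop_mul1l. Qed.

Lemma left_nucleusM a b :
  left_nucleus Q a -> left_nucleus Q b -> left_nucleus Q (a * b).
Proof. by move=> Na Nb x y; rewrite -Na Nb Na Na. Qed.

Lemma left_nucleusV a :
  left_nucleus Q a ->
  exists a', [/\ left_nucleus Q a', a * a' = 1 & a' * a = 1].
Proof.
move=> Na; have [a' aa'] := loop_ldiv a 1; exists a'; split=> // [x y|];
  apply: (@loop_mulI a); by rewrite !Na aa' ?loop_mul1l ?loop_mulr1.
Qed.

(** Membership in the middle nucleus supplies the associativity that divides
    on the right by an element of the left nucleus. *)
Lemma left_nucleus_subloop :
  left_nucleus Q `<=` middle_nucleus Q -> subloop (left_nucleus Q).
Proof.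
move=> subM; split; first exact: left_nucleus1.
  move=> a Na; split; first by move=> b Nb; apply: left_nucleusM.
    by move=> x y _ _; apply: loop_mulI.
  move=> b Nb; have [a' [Na' aa' _]] := left_nucleusV Na.
  by exists (a' * b); [apply: left_nucleusM | rewrite Na aa' loop_mul1l].
move=> a Na; split; first by move=> b Nb; apply: left_nucleusM.
  by move=> x y _ _; apply: loop_mulIr.
move=> b Nb; have [a' [Na' _ a'a]] := left_nucleusV Na.
exists (b * a'); first exact: left_nucleusM.
by rewrite -(subM _ Na') a'a loop_mulr1.
Qed.

Lemma mlt_bij (f : Q -> Q) : mlt f -> bijective f.
Proof.
elim=> [x|x||{}f g _ bf _ bg|{}f g _ _ fK gK].
- exact: loop_left_bij.
- exact: loop_right_bij.
- by exists id.
- exact: bij_comp.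
- by exists f.
Qed.

Hypothesis HQ : osborn Q.

(** The composite L_x L_a L_x^-1 is again a left translation by some b in the
    left nucleus: L_a commutes with R_x, so it is the third component of the
    conjugate of (L_a, id, L_a) by (alpha, R_x, L_x R_x). *)
Lemma left_nucleus_conj x a : left_nucleus Q a ->
  exists2 b, left_nucleus Q b & forall w, x * (a * w) = b * (x * w).
Proof.
move=> Na; have [alpha [[beta alphaK betaK] alphaE]] := HQ x.
have alphaM y z : alpha (a * y) * (z * x) = x * (a * ((y * z) * x)).
  by rewrite alphaE -!Na.
pose b := alpha (a * beta 1).
have bE w : x * (a * w) = b * (x * w).
  have [u <-] := loop_rdiv x w; have [z <-] := loop_ldiv (beta 1) u.
  by rewrite -alphaM -alphaE betaK loop_mul1l.
exists b => // u v; have [z <-] := loop_rdiv x v.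
rewrite -(betaK u) alphaE -bE -alphaM; congr (_ * _).
have [z1 z1x] := loop_rdiv x 1.
by rewrite -[LHS]loop_mulr1 -z1x alphaM bE -alphaE z1x loop_mulr1.
Qed.

(** The mirror statement, read off the second component of the conjugate of
    (id, R_a, R_a). *)
Lemma right_nucleus_conj x a : right_nucleus Q a ->
  exists2 c, right_nucleus Q c & forall z, (z * a) * x = (z * x) * c.
Proof.
move=> Na; have [alpha [[beta alphaK betaK] alphaE]] := HQ x.
have alphaM y z : alpha y * ((z * a) * x) = x * (((y * z) * a) * x).
  by rewrite alphaE Na.
have [z1 z1x] := loop_rdiv x 1.
pose c := (z1 * a) * x.
have cE w : (x * (w * x)) * c = x * ((w * a) * x).
  have [y <-] := loop_rdiv z1 w.
  by rewrite -alphaE z1x loop_mulr1 alphaM.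
have c_conj z : (z * a) * x = (z * x) * c.
  by rewrite -[LHS]loop_mul1l -(betaK 1) alphaM -cE -alphaE betaK loop_mul1l.
exists c => // u v; have [z <-] := loop_rdiv x v.
by rewrite -(betaK u) alphaE cE -c_conj alphaM.
Qed.

Lemma left_sub_middle : left_nucleus Q `<=` middle_nucleus Q.
Proof.
move=> a Na x w; have [b Nb bE] := left_nucleus_conj x Na.
by rewrite bE Nb -[a in RHS]loop_mulr1 bE loop_mulr1.
Qed.

Lemma right_sub_middle : right_nucleus Q `<=` middle_nucleus Q.
Proof.
move=> a Na z x; have [c Nc cE] := right_nucleus_conj x Na.
by rewrite cE Nc -[a in LHS]loop_mul1l cE loop_mul1l.
Qed.

(** Conjugation fixes the third component id of (R_a, L_a^-1, id), so it gives
    the autotopism of some b; its second component yields (az)x = b(zx),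
    and z = 1 forces b = a. *)
Lemma middle_sub_left : middle_nucleus Q `<=` left_nucleus Q.
Proof.
move=> a Na z x; have [alpha [[beta _ betaK] alphaE]] := HQ x.
pose b := alpha (beta 1 * a).
have bE w : b * (w * x) = (a * w) * x.
  by rewrite alphaE -Na -alphaE betaK loop_mul1l.
suff ba : b = a by rewrite -{1}ba bE.
by apply: (@loop_mulIr x); have := bE 1; rewrite loop_mul1l loop_mulr1.
Qed.

(** Dividing (L_a, id, L_a) out of the autotopism (alpha, R_a, L_a R_a) that
    the Osborn law gives at a leaves (L_a^-1 alpha, R_a, R_a); evaluating it
    at z = 1 shows L_a^-1 alpha = id. *)
Lemma left_sub_right : left_nucleus Q `<=` right_nucleus Q.
Proof.
move=> a Na y z; have [alpha [_ alphaE]] := HQ a.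
have [u uE] := loop_ldiv a (alpha y).
have uM w : u * (w * a) = (y * w) * a.
  by apply: (@loop_mulI a); rewrite Na uE alphaE.
rewrite -uM; congr (_ * _).
by apply: (@loop_mulIr a); have := uM 1; rewrite loop_mul1l loop_mulr1.
Qed.

Lemma left_nucleus_eq_middle : left_nucleus Q = middle_nucleus Q.
Proof.
by apply/seteqP; split; [apply: left_sub_middle | apply: middle_sub_left].
Qed.

Lemma middle_nucleus_eq_right : middle_nucleus Q = right_nucleus Q.
Proof.
apply/seteqP; split; last exact: right_sub_middle.
exact: subset_trans middle_sub_left left_sub_right.
Qed.

Lemma nucleus_eq_left : nucleus Q = left_nucleus Q.
Proof.
by rewrite /nucleus -middle_nucleus_eq_right -left_nucleus_eq_middle !setIid.
Qed.

Definition same_coset x y := exists2 a, left_nucleus Q a & y = x * a.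

Lemma same_coset1 y : same_coset 1 y <-> left_nucleus Q y.
Proof.
split=> [[a Na ->]|Ny]; first by rewrite loop_mul1l.
by exists y; rewrite ?loop_mul1l.
Qed.

(** Since x N = N x, right translations also permute the cosets.  Stating the
    invariance as an equivalence makes it pass to inverse maps. *)
Lemma mlt_coset (f : Q -> Q) : mlt f ->
  forall x y, same_coset (f x) (f y) <-> same_coset x y.
Proof.
elim=> [z|z||{}f g _ Hf _ Hg|{}f g _ Hf _ gK] x y //.
- split=> [[a Na zyE]|[a Na ->]]; exists a => //.
    by apply: (@loop_mulI z); rewrite zyE (left_sub_right Na).
  by rewrite (left_sub_right Na).
- split=> [[b Nb yzE]|[a Na ->]].
    have [a Na aE] := left_nucleus_conj z Nb.
    have az_zb : a * z = z * b by rewrite -[z in LHS]loop_mulr1 -aE loop_mulr1.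
    exists a => //; apply: (@loop_mulIr z).
    by rewrite yzE (left_sub_right Nb) -az_zb (left_sub_middle Na).
  have [c Nc cE] := right_nucleus_conj z (left_sub_right Na).
  by exists c; [apply/middle_sub_left/right_sub_middle | rewrite cE].
- by rewrite /= Hf.
- by rewrite -Hf !gK.
Qed.

Lemma inner_mapping_nucleus (f : Q -> Q) :
  inner_mapping f -> f @` left_nucleus Q = left_nucleus Q.
Proof.
move=> [mf f1]; have fN y : left_nucleus Q (f y) <-> left_nucleus Q y.
  by rewrite -same_coset1 -[in X in X <-> _]f1 mlt_coset // same_coset1.
have [g _ gK] := mlt_bij mf.
apply/seteqP; split=> [_ [y Ny <-]|y Ny]; first exact/fN.
by exists (g y) => //; apply/fN; rewrite gK.
Qed.

End Loop.

Theorem theorem3p11 (Q : loopType) (HQ : osborn Q) :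
  [/\ left_nucleus Q = middle_nucleus Q,
      middle_nucleus Q = right_nucleus Q &
      normal_subloop (nucleus Q)].
Proof.
split; [exact: left_nucleus_eq_middle | exact: middle_nucleus_eq_right |].
rewrite (nucleus_eq_left HQ); split.
  exact/left_nucleus_subloop/left_sub_middle.
by move=> f; apply: inner_mapping_nucleus.
Qed.
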